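(* Let $\mathcal{H}$ be a complex Hilbert space, let $d\geq 1$, and let $\mathbf{T}=(T_1,\ldots,T_d)\in\mathcal{B}(\mathcal{H})^d$ be a $d$-tuple of bounded linear operators on $\mathcal{H}$. Let $\widehat{\mathbf{T}}$ be the spherical Aluthge transform of $\mathbf{T}$. Then $$\|\widehat{\mathbf{T}}\|\leq\|\mathbf{T}\|,$$ where $\|\cdot\|$ denotes the joint operator norm of a $d$-tuple.
   Context: $\mathcal{B}(\mathcal{H})$ is the algebra of bounded linear operators on the complex Hilbert space $\mathcal{H}$ with inner product $\langle\cdot\mid\cdot\rangle$. The operators $T_k$ are not assumed to commute. Joint operator norm: for $\mathbf{T}=(T_1,\ldots,T_d)\in\mathcal{B}(\mathcal{H})^d$, $\|\mathbf{T}\|:=\sup\{(\sum_{k=1}^d\|T_kx\|^2)^{1/2}: x\in\mathcal{H},\ \|x\|=1\}$. Polar decomposition of a tuple: regard $\mathbf{T}$ as the operator $S:\mathcal{H}\to\bigoplus_{i=1}^d\mathcal{H}$, $Sx=(T_1x,\ldots,T_dx)$. Let $S=VP$ be its (canonical) polar decomposition, so $P=(S^*S)^{1/2}=\sqrt{T_1^*T_1+\cdots+T_d^*T_d}$ is a positive operator on $\mathcal{H}$ and $V:\mathcal{H}\to\bigoplus_{i=1}^d\mathcal{H}$, $Vx=(V_1x,\ldots,V_dx)$, is the partial isometry with $\mathcal{N}(V)=\bigcap_{i}\mathcal{N}(V_i)=\mathcal{N}(P)=\bigcap_i\mathcal{N}(T_i)$. Thus $T_k=V_kP$ for $1\le k\le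 d$. Spherical Aluthge transform: $\widehat{\mathbf{T}}=(\widehat{T_1},\ldots,\widehat{T_d}):=(\sqrt{P}V_1\sqrt{P},\ldots,\sqrt{P}V_d\sqrt{P})$. *)

(* Defs.v *)
From HB Require Import structures.
From mathcomp Require Import all_boot all_order all_algebra.
From mathcomp Require Import sesquilinear complex.
From mathcomp Require Import all_classical all_reals all_analysis.

Set Implicit Arguments.
Unset Strict Implicit.
Unset Printing Implicit Defensive.

Import Order.TTheory GRing.Theory Num.Theory.
Import numFieldNormedType.Exports.

Local Open Scope classical_set_scope.
Local Open Scope ring_scope.
Local Open Scope complex_scope.

(* A complex Hilbert space: a Banach space over R[i] whose norm comes from a
   positive definite sesquilinear form, linear in its first argument. *)
HB.mixin Record CompleteNormedModule_isHilbert (R : realType) H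
    of CompleteNormedModule R[i] H := {
  inner : {dot H for (@Num.conj R[i])} ;
  inner_norm : forall x : H, inner x x = `|x| ^+ 2
}.

#[short(type="hilbertType")]
HB.structure Definition Hilbert (R : realType) :=
  {H of CompleteNormedModule R[i] H & CompleteNormedModule_isHilbert R H}.

Arguments inner {R H} : rename.

(* {ffun 'I_d -> H} with the inner product below is the Hilbert direct sum of
   d copies of H. *)
Definition dsum_inner (R : realType) (H : hilbertType R) (d : nat)
    (u v : {ffun 'I_d -> H}) : R[i] := \sum_k inner (u k) (v k).

Section DsumInner.
Variables (R : realType) (H : hilbertType R) (d : nat).

Fact dsum_inner_bilinear :
  bilinear_for *%R ((@Num.conj R[i]) \; *%R) (@dsum_inner R H d).
Proof.
split=> [u' a x y | u a x y]; rewrite /dsum_inner /= mulr_sumr -big_split /=;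
  apply: eq_bigr => k _; rewrite !ffunE.
- by rewrite linearPl.
- by rewrite linearPr.
Qed.

HB.instance Definition _ := bilinear_isBilinear.Build R[i]
  {ffun 'I_d -> H} {ffun 'I_d -> H} R[i] *%R (Num.conj \; *%R)
  (@dsum_inner R H d) dsum_inner_bilinear.

Fact dsum_inner_hermitian (u v : {ffun 'I_d -> H}) :
  dsum_inner u v = (-1) ^+ false * Num.conj (dsum_inner v u).
Proof.
rewrite expr0 mul1r /dsum_inner rmorph_sum /=; apply: eq_bigr => k _.
by rewrite [LHS]hermC expr0 mul1r.
Qed.

HB.instance Definition _ := isHermitianSesquilinear.Build R[i]
  {ffun 'I_d -> H} false (@Num.conj R[i]) (@dsum_inner R H d)
  dsum_inner_hermitian.

Fact dsum_inner_gt0 (u : {ffun 'I_d -> H}) : u != 0 -> 0 < dsum_inner u u.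
Proof.
move=> u0; have [k uk0] : exists k, u k != 0.
  apply/existsP; apply: contraR u0 => /existsPn uE.
  by apply/eqP/ffunP => k; rewrite ffunE; apply/eqP; have /negPn := uE k.
rewrite /dsum_inner (bigD1 k) //= ltr_wpDr //; last first.
  by rewrite inner_norm exprn_gt0 // normr_gt0.
by apply: sumr_ge0 => i _; rewrite inner_norm exprn_ge0.
Qed.

HB.instance Definition _ := isDotProduct.Build R[i]
  {ffun 'I_d -> H} (@dsum_inner R H d) dsum_inner_gt0.

End DsumInner.

Definition hnorm (R : realType) (U : lmodType R[i])
    (f : {dot U for (@Num.conj R[i])}) (x : U) : R := Num.sqrt (complex.Re (f x x)).

Fact hnorm_inner (R : realType) (H : hilbertType R) (x : H) :
  (hnorm inner x)%:C = `|x|.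
Proof.
rewrite /hnorm inner_norm.
have /complex_realP [r xE] : `|x| \is Num.real by exact: normr_real.
have r0 : 0 <= r by rewrite -lecR -xE normr_ge0.
by rewrite xE -rmorphXn /= sqrtr_sqr ger0_norm.
Qed.

Section Operators.
Variables (R : realType) (U W : lmodType R[i]).
Variables (f : {dot U for (@Num.conj R[i])}) (g : {dot W for (@Num.conj R[i])}).

Definition is_bounded (A : U -> W) : Prop :=
  exists M : R, forall x, hnorm g (A x) <= M * hnorm f x.

Definition is_adjoint (A : U -> W) (B : W -> U) : Prop :=
  forall x y, g (A x) y = f x (B y).

End Operators.

Section Positive.
Variables (R : realType) (U : lmodType R[i]).
Variable f : {dot U for (@Num.conj R[i])}.

(* The order of R[i] makes 0 <= z entail that z is real. *)
Definition is_positive (A : U -> U) : Prop := forall x, 0 <= f (A x) x.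

Definition is_positive_sqrt (Q A : U -> U) : Prop :=
  [/\ is_bounded f f Q, is_positive Q & forall x, Q (Q x) = A x].

End Positive.

Section Polar.
Variables (R : realType) (U W : lmodType R[i]).
Variables (f : {dot U for (@Num.conj R[i])}) (g : {dot W for (@Num.conj R[i])}).

Definition is_partial_isometry (V : U -> W) : Prop :=
  is_bounded f g V /\
  forall x, (forall y, V y = 0 -> f x y = 0) -> hnorm g (V x) = hnorm f x.

Definition is_polar_decomposition (S V : {linear U -> W}) (P : {linear U -> U})
  : Prop :=
  [/\ exists2 Sadj : {linear W -> U},
        is_adjoint f g S Sadj & is_positive_sqrt f P (Sadj \o S),
      is_partial_isometry V,
      forall x, V x = 0 <-> P x = 0
    & forall x, S x = V (P x)].

End Polar.

Section Tuples.
Variables (R : realType) (H : hilbertType R) (d : nat).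
Implicit Types T That : 'I_d -> {linear H -> H}.

(* Over the zero space the supremum is that of the empty set, which is 0. *)
Definition joint_norm T : R :=
  sup [set Num.sqrt (\sum_k hnorm inner (T k x) ^+ 2) |
       x in [set x : H | hnorm inner x = 1]].

Definition column_op T (x : H) : {ffun 'I_d -> H} := [ffun k => T k x].

Fact column_op_linear T : linear (column_op T).
Proof. by move=> a x y; apply/ffunP => k; rewrite !ffunE linearP. Qed.

HB.instance Definition _ T := GRing.isLinear.Build R[i] H {ffun 'I_d -> H} _
  (column_op T) (column_op_linear T).

Definition is_spherical_aluthge T That : Prop :=
  exists (V : {linear H -> {ffun 'I_d -> H}}) (P Q : {linear H -> H}),
  [/\ is_polar_decomposition inner (@dsum_inner R H d) (column_op T) V P,
      is_positive_sqrt inner Q P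
    & forall k x, That k x = Q (V (Q x) k)].

End Tuples.

(* Main.v *)
Require Import Defs.
From mathcomp Require Import all_boot all_order all_algebra.
From mathcomp Require Import complex all_classical all_reals all_analysis.
From mathcomp Require Import sesquilinear ring.

(** Regard the tuple as the column operator [S = VP], so that
    [|Sx|^2 = <S^* S x, x> = |Px|^2]: the joint norm [N] of [T] is the operator
    norm of [P]. With [Q] the square root of [P], the column operator of the
    transform sends [x] to the tuple of the [Q (V_k Q x)], and

      sum_k |Q V_k Q x|^2 = sum_k <P V_k Q x, V_k Q x>
                         <= N sum_k |V_k Q x|^2
                          = N |Q x|^2 = N <P x, x> <= N^2 |x|^2.

    Both inequalities are [positive_le_scalar], the bound [<Pu, u> <= N |u|^2]
    for a positive operator of norm at most [N]. The middle equality
    [|V Q x| = |Q x|] holds because [V] is isometric on the orthogonal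
    complement of its kernel, which is the kernel of [P = Q^2], hence that of
    the self-adjoint operator [Q], and is therefore orthogonal to the range of
    [Q]. *)

Import Order.TTheory GRing.Theory Num.Theory.
Local Open Scope ring_scope.
Local Open Scope complex_scope.

Lemma hnorm_ge0 (R : realType) (U : lmodType R[i])
    (f : {dot U for (@Num.conj R[i])}) (x : U) : 0 <= hnorm f x.
Proof. exact: sqrtr_ge0. Qed.

Lemma sqr_hnorm (R : realType) (U : lmodType R[i])
    (f : {dot U for (@Num.conj R[i])}) (x : U) :
  (hnorm f x)%:C ^+ 2 = f x x.
Proof.
have fx0 : 0 <= f x x by exact: dnorm_ge0.
rewrite -rmorphXn /= /hnorm sqr_sqrtr ?RRe_real ?ger0_real //.
by rewrite -ler0c RRe_real ?ger0_real.
Qed.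

Lemma hnormZ (R : realType) (U : lmodType R[i])
    (f : {dot U for (@Num.conj R[i])}) (c : R) (x : U) : 0 <= c ->
  hnorm f (c%:C *: x) = c * hnorm f x.
Proof.
move=> c0; apply: complexI; rewrite rmorphM /=; apply/eqP.
rewrite -(@eqrXn2 _ 2) ?mulr_ge0 ?ler0c ?hnorm_ge0 //.
by rewrite exprMn !sqr_hnorm dnormZ ger0_norm ?ler0c.
Qed.

Lemma hnorm_eq (R : realType) (U W : lmodType R[i])
    (f : {dot U for (@Num.conj R[i])}) (g : {dot W for (@Num.conj R[i])})
    (x : U) (y : W) :
  f x x = g y y -> hnorm f x = hnorm g y.
Proof. by rewrite /hnorm => ->. Qed.

Lemma hnorm_le_scale (R : realType) (U W : lmodType R[i])
    (f : {dot U for (@Num.conj R[i])}) (g : {dot W for (@Num.conj R[i])})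
    (c : R) (x : U) (y : W) : 0 <= c ->
  (hnorm f x <= c * hnorm g y) = (f x x <= c%:C ^+ 2 * g y y).
Proof.
move=> c0; rewrite -!sqr_hnorm -!rmorphXn -rmorphM /= lecR -exprMn.
by rewrite ler_sqr ?nnegrE ?mulr_ge0 ?hnorm_ge0.
Qed.

(** The form [h x y = <Ax, y> - <x, Ay>] vanishes on the diagonal because every
    [<Ax, x>] is real. Expanding [h (x + y) (x + y)] gives
    [h x y + h y x = 0], and replacing [y] by [iy] in this identity gives
    [h x y - h y x = 0]. *)
Lemma positive_self_adjoint (R : realType) (U : lmodType R[i])
    (f : {dot U for (@Num.conj R[i])}) (A : {linear U -> U}) :
  is_positive f A -> is_adjoint f f A A.
Proof.
move=> A0; pose h x y := f (A x) y - f x (A y).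
have hxx x : h x x = 0.
  rewrite /h [X in _ - X]hermC expr0 mul1r /=.
  by rewrite (CrealP (ger0_real (A0 x))) subrr.
have hD x y : h x y + h y x = 0.
  have hDxy : h (x + y) (x + y) = h x x + h y y + (h x y + h y x).
    by rewrite /h !linearD /= !linearDl; ring.
  by rewrite -[LHS]add0r -[in LHS](addr0 0) -{1}(hxx x) -(hxx y) -hDxy hxx.
have hDi x y : h x y - h y x = 0.
  have hDi_xy : h x ('i%R *: y) + h ('i%R *: y) x = - 'i%R * (h x y - h y x).
    rewrite /h !(linearZZ A) /= !linearZl_LR !linearZr_LR /= conjCi; ring.
  apply/eqP; rewrite -(mulrI_eq0 _ (mulfI (_ : - 'i%R != 0))) -?hDi_xy ?hD //.
  by rewrite oppr_eq0 neq0Ci.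
move=> x y; apply/eqP; rewrite -subr_eq0 -/(h x y).
have /eqP : h x y *+ 2 = 0.
  by rewrite mulr2n -[RHS](addr0 0) -{1}(hD x y) -(hDi x y); ring.
by rewrite mulrn_eq0.
Qed.

(** Expanding [0 <= |Ax - cx|^2] gives
    [2 c <Ax, x> <= |Ax|^2 + c^2 |x|^2 <= 2 c^2 |x|^2]; when [c = 0] the
    hypothesis forces [Ax = 0]. *)
Lemma positive_le_scalar (R : realType) (U : lmodType R[i])
    (f : {dot U for (@Num.conj R[i])}) (A : {linear U -> U}) (c : R) :
  is_positive f A -> 0 <= c ->
  (forall x, hnorm f (A x) <= c * hnorm f x) ->
  forall x, f (A x) x <= c%:C * f x x.
Proof.
move=> A0; rewrite le_eqVlt => /predU1P[<-|c_gt0] Ac x.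
  move: (Ac x); rewrite hnorm_le_scale // rmorph0 expr0n /= mul0r => Ax_le0.
  have /eqP -> : A x == 0 by rewrite -(dnorm_eq0 f) eq_le Ax_le0 dnorm_ge0.
  by rewrite linear0l.
have c0 := ltW c_gt0.
move: (Ac x); rewrite hnorm_le_scale // => Ax_le.
have cJ : Num.conj c%:C = c%:C by rewrite conj_Creal // ger0_real // ler0c.
have AxJ : Num.conj (f (A x) x) = f (A x) x by rewrite conj_Creal // ger0_real.
have := dnorm_ge0 f (A x - c%:C *: x).
rewrite dnormB dnormZ linearZr_LR /= rmorphM /= !cJ AxJ.
rewrite ger0_norm ?ler0c // -mulr2n subr_ge0 => le2.
have {}le2 := le_trans le2 (lerD Ax_le (lexx _)).
move: le2; rewrite -mulr2n lerMn2r /= expr2 -mulrA ler_pM2l //.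
by rewrite ltcR.
Qed.

Lemma joint_norm_column (R : realType) (H : hilbertType R) (d : nat)
    (T : 'I_d -> {linear H -> H}) (x : H) :
  Num.sqrt (\sum_k hnorm inner (T k x) ^+ 2)
  = hnorm (@dsum_inner R H d) (column_op T x).
Proof.
rewrite /hnorm; congr Num.sqrt; apply: complexI.
rewrite RRe_real; last by apply: ger0_real; exact: dnorm_ge0.
rewrite rmorph_sum /=; apply: eq_bigr => k _.
by rewrite rmorphXn /= sqr_hnorm ffunE.
Qed.

Lemma joint_norm_le (R : realType) (H : hilbertType R) (d : nat)
    (T : 'I_d -> {linear H -> H}) (c : R) : 0 <= c ->
  (forall x, hnorm (@dsum_inner R H d) (column_op T x) <= c * hnorm inner x) ->
  joint_norm T <= c.
Proof.
move=> c0 Tc; rewrite /joint_norm; set E := (X in sup X).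
(* Over the zero space there is no unit vector, and [sup set0 = 0]. *)
have [->|/set0P [y Ey]] := eqVneq E set0; first by rewrite sup0.
apply: ge_sup; first by exists y.
by move=> _ [x /= x1 <-]; rewrite joint_norm_column -[leRHS]mulr1 -x1.
Qed.

Lemma joint_norm_ge0 (R : realType) (H : hilbertType R) (d : nat)
    (T : 'I_d -> {linear H -> H}) : 0 <= joint_norm T.
Proof.
rewrite /joint_norm; set E := (X in sup X).
have [supE|/sup_out -> //] := pselect (has_sup E).
have [y Ey] := supE.1; apply: (@le_trans _ _ y); last exact: sup_upper_bound.
by case: Ey => x _ <-; exact: sqrtr_ge0.
Qed.

Lemma column_le_joint_norm (R : realType) (H : hilbertType R) (d : nat)
    (T : 'I_d -> {linear H -> H}) :
  is_bounded inner (@dsum_inner R H d) (column_op T) ->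
  forall x, hnorm (@dsum_inner R H d) (column_op T x)
            <= joint_norm T * hnorm inner x.
Proof.
move=> [M TM] x; have [->|x0] := eqVneq x 0.
  by rewrite hnorm_le_scale ?joint_norm_ge0 // !linear0 mulr0.
set r := hnorm inner x.
have r0 : 0 < r.
  rewrite lt_def hnorm_ge0 andbT; apply: contra_neq x0 => r0.
  by apply/eqP; rewrite -(dnorm_eq0 inner) -sqr_hnorm -/r r0 expr0n.
have rV0 : 0 <= r^-1 by rewrite invr_ge0 ltW.
rewrite -ler_pdivrMr // mulrC -hnormZ // -linearZ /= -joint_norm_column.
apply: ub_le_sup.
  by exists M => _ [y /= y1 <-]; rewrite joint_norm_column -[M]mulr1 -y1.
by exists (r^-1%:C *: x) => //=; rewrite hnormZ // mulVf // gt_eqF.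
Qed.

Lemma polar_hnorm (R : realType) (U W : lmodType R[i])
    (f : {dot U for (@Num.conj R[i])}) (g : {dot W for (@Num.conj R[i])})
    (S V : {linear U -> W}) (P : {linear U -> U}) :
  is_polar_decomposition f g S V P ->
  forall x, hnorm g (S x) = hnorm f (P x).
Proof.
move=> [[Sadj SS [_ P0 PP]] _ _ _] x; apply: hnorm_eq.
by rewrite SS -[Sadj _]PP (positive_self_adjoint _ _ _ _ P0).
Qed.

(** The kernel of [V] is that of [P = Q^2], on which
    [|Qy|^2 = <Q^2 y, y> = 0]; hence it is orthogonal to [Qx], and [V] is
    isometric there. *)
Lemma polar_isometry_sqrt (R : realType) (U W : lmodType R[i])
    (f : {dot U for (@Num.conj R[i])}) (g : {dot W for (@Num.conj R[i])})
    (S V : {linear U -> W}) (P Q : {linear U -> U}) :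
  is_polar_decomposition f g S V P -> is_positive_sqrt f Q P ->
  forall x, hnorm g (V (Q x)) = hnorm f (Q x).
Proof.
move=> [_ [_ Viso] kerV _] [_ Q0 QQ] x; apply: Viso => y /kerV Py0.
have Qsym := positive_self_adjoint _ _ _ _ Q0.
have /eqP : f (Q y) (Q y) = 0 by rewrite -Qsym QQ Py0 linear0l.
by rewrite dnorm_eq0 Qsym => /eqP ->; rewrite linear0r.
Qed.

Theorem theorem2p1 (R : realType) (H : hilbertType R) (d : nat)
    (T That : 'I_d -> {linear H -> H}) :
  (1 <= d)%N ->
  (forall k, is_bounded inner inner (T k)) ->
  is_spherical_aluthge T That ->
  joint_norm That <= joint_norm T.
Proof.
move=> _ _ [V [P [Q [polar Qsqrt ThatE]]]].
have N0 := joint_norm_ge0 _ _ _ T; set N := joint_norm T in N0 *.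
have [[Sadj _ [[M PM] P0 _]] _ _ _] := polar; have [_ Q0 QQ] := Qsqrt.
have Qsym := positive_self_adjoint _ _ _ _ Q0.
have SP := polar_hnorm _ _ _ _ _ _ _ _ polar.
have PN x : hnorm inner (P x) <= N * hnorm inner x.
  rewrite -SP; apply: column_le_joint_norm.
  by exists M => y; rewrite [leLHS]SP.
have PleN := positive_le_scalar _ _ _ _ _ P0 N0 PN.
apply: joint_norm_le => // x; rewrite hnorm_le_scale //.
have step1 : dsum_inner (column_op That x) (column_op That x)
    <= N%:C * dsum_inner (V (Q x)) (V (Q x)).
  rewrite /dsum_inner mulr_sumr; apply: ler_sum => k _.
  by rewrite !ffunE ThatE -Qsym QQ.
apply: le_trans step1 _; rewrite expr2 -mulrA ler_wpM2l ?ler0c //.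
rewrite -[leLHS]sqr_hnorm (polar_isometry_sqrt _ _ _ _ _ _ _ _ _ polar Qsqrt).
by rewrite sqr_hnorm -Qsym QQ.
Qed.
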